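(* Let $R$ be a principal ideal domain and let $M,N$ be modules over $R$. If there is an element $r\in R$ such that $r$ is regular on $M$ and $rN=0$, then $\operatorname{Ext}_{R}^{1}(M,N)=0$.
   Context: An element $r\in R$ is regular on an $R$-module $M$ if multiplication by $r$ on $M$ is injective (it is not required that $M\neq rM$). *)

(* Defs.v *)
From HB Require Import structures.
From mathcomp Require Import all_boot all_order all_algebra.
From mathcomp Require Import boolp classical_sets.
From mathcomp Require Import freeg.

Set Implicit Arguments.
Unset Strict Implicit.
Unset Printing Implicit Defensive.

Import GRing.Theory.
Local Open Scope ring_scope.

(* ring_quotient's [idealr] only covers proper ideals given by a boolean
   predicate, hence this version on arbitrary sets. *)
Definition is_ideal (R : comNzRingType) (I : set R) : Prop :=
  [/\ I 0, forall x y, I x -> I y -> I (x + y) & forall a x, I x -> I (a * x)].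

Definition principal_ideal_domain (R : idomainType) : Prop :=
  forall I : set R, is_ideal I ->
    exists a : R, forall x, I x <-> exists b, x = b * a.

Definition regular_on (R : comNzRingType) (M : lmodType R) (r : R) : Prop :=
  injective (fun x : M => r *: x).

Definition annihilates (R : comNzRingType) (N : lmodType R) (r : R) : Prop :=
  forall x : N, r *: x = 0.

Section Hom.
Variables (R : comNzRingType) (U V : lmodType R).

Definition hom : Type := {linear U -> V}.

HB.instance Definition _ := gen_eqMixin hom.
HB.instance Definition _ := gen_choiceMixin hom.

Lemma homP (f g : {linear U -> V}) : f =1 g -> f = g :> hom.
Proof.
move=> fg; have : (f : U -> V) = g by apply/funext.
case: f {fg} => f [[a1] [a2]]; case: g => g [[b1] [b2]] /= e.
by case: _ / e in b1 b2 *; rewrite (Prop_irrelevance a1 b1) (Prop_irrelevance a2 b2).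
Qed.

Definition hom0 : hom := (\0 : {linear U -> V}).
Definition homN (f : hom) : hom := (\- (f : {linear U -> V}) : {linear U -> V}).
Definition homD (f g : hom) : hom :=
  ((f : {linear U -> V}) \+ (g : {linear U -> V}) : {linear U -> V}).

Lemma homDA : associative homD.
Proof. by move=> f g h; apply: homP => x /=; rewrite addrA. Qed.
Lemma homDC : commutative homD.
Proof. by move=> f g; apply: homP => x /=; rewrite addrC. Qed.
Lemma hom0D : left_id hom0 homD.
Proof. by move=> f; apply: homP => x /=; rewrite add0r. Qed.
Lemma homND : left_inverse hom0 homN homD.
Proof. by move=> f; apply: homP => x /=; rewrite addNr. Qed.

HB.instance Definition _ := GRing.isZmodule.Build hom homDA homDC hom0D homND.

End Hom.

Section Precomposition.
Variables (R : comNzRingType) (U U' V : lmodType R) (d : {linear U' -> U}).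

Definition precomp (f : hom U V) : hom U' V :=
  ((f : {linear U -> V}) \o d : {linear U' -> V}).

Lemma precompB f g : precomp (f - g) = precomp f - precomp g.
Proof. by apply: homP. Qed.

Lemma precomp0 : precomp 0 = 0.
Proof. by apply: homP. Qed.

End Precomposition.

Definition projective (R : comNzRingType) (P : lmodType R) : Prop :=
  forall (A B : lmodType R) (p : {linear A -> B}) (f : {linear P -> B}),
    (forall b, exists a, p a = b) ->
    exists g : {linear P -> A}, forall x, p (g x) = f x.

(* ... -> P 2 -> P 1 -> P 0 -> M -> 0, where d n : P n.+1 -> P n *)
Record projective_resolution (R : comNzRingType) (M : lmodType R) := {
  res_obj :> nat -> lmodType R;
  res_d : forall n, {linear res_obj n.+1 -> res_obj n};
  res_aug : {linear res_obj 0%N -> M};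
  res_proj : forall n, projective (res_obj n);
  res_aug_surj : forall m, exists x, res_aug x = m;
  res_exact0 : forall x, res_aug x = 0 <-> exists y, res_d 0%N y = x;
  res_exact : forall n x, res_d n x = 0 <-> exists y, res_d n.+1 y = x
}.

Definition is_coboundary (R : comNzRingType) (M : lmodType R)
    (P : projective_resolution M) (N : lmodType R) (n : nat) :
    hom (P n) N -> Prop :=
  match n return hom (P n) N -> Prop with
  | 0 => fun f => f = 0
  | k.+1 => fun f => exists g : hom (P k) N, f = precomp (res_d P k) g
  end.

(* Ext n is the n-th cohomology group of the complex
   0 -> Hom(P 0, N) -> Hom(P 1, N) -> Hom(P 2, N) -> ... *)
Section Ext.
Variables (R : comNzRingType) (M : lmodType R) (P : projective_resolution M).
Variables (N : lmodType R) (n : nat).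

Definition cocycle : pred (hom (P n) N) := fun f => precomp (res_d P n) f == 0.

Lemma cocycle_zmod_closed : zmod_closed cocycle.
Proof.
split=> [|f g]; rewrite !unfold_in /cocycle ?precomp0 //.
by rewrite precompB => /eqP -> /eqP ->; rewrite subrr.
Qed.
HB.instance Definition _ :=
  GRing.isZmodClosed.Build (hom (P n) N) cocycle cocycle_zmod_closed.

Definition cocycles : Type := {f : hom (P n) N | cocycle f}.
HB.instance Definition _ := SubChoice.on cocycles.
HB.instance Definition _ := [SubChoice_isSubZmodule of cocycles by <:].

Lemma is_coboundary_zmod_closed :
  is_coboundary (0 : hom (P n) N) /\
  forall f g : hom (P n) N,
    is_coboundary f -> is_coboundary g -> is_coboundary (f - g).
Proof.
case: n => [|k] /=; split=> //; first by move=> f g -> ->; rewrite subrr.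
  by exists 0; rewrite precomp0.
by move=> f g [a ->] [b ->]; exists (a - b); rewrite precompB.
Qed.

Definition coboundary : pred cocycles := fun f => `[< is_coboundary (val f) >].

Lemma coboundary_zmod_closed : zmod_closed coboundary.
Proof.
split=> [|f g]; rewrite !unfold_in /coboundary.
  by apply/asboolP; rewrite raddf0; apply: is_coboundary_zmod_closed.1.
move=> /asboolP Bf /asboolP Bg; apply/asboolP; rewrite raddfB.
exact: is_coboundary_zmod_closed.2.
Qed.
HB.instance Definition _ :=
  GRing.isZmodClosed.Build cocycles coboundary coboundary_zmod_closed.

Definition Ext : zmodType := Quotient.quot (GRing.ZmodClosed.clone cocycles coboundary _).

Lemma Ext_eq0P : (forall e : Ext, e = 0) <->
  forall f : hom (P n) N, precomp (res_d P n) f = 0 -> is_coboundary f.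
Proof.
split=> [E0 f /eqP f0 | H e].
  pose z : cocycles := exist _ f f0.
  have := E0 (\pi_(Ext)%qT z); rewrite -(raddf0 (\pi_(Ext)%qT)) => /eqP.
  by rewrite -Quotient.idealrBE subr0 => /asboolP.
rewrite -[e]reprK -(raddf0 (\pi_(Ext)%qT)); apply/eqP.
rewrite -Quotient.idealrBE subr0; apply/asboolP/H/eqP.
exact: (valP (repr e)).
Qed.

End Ext.

(* Every module has a projective resolution, so a statement about all
   projective resolutions of a module is never vacuous. *)
Section FreeResolution.
Variable R : comNzRingType.

Lemma freegUZ (K : choiceType) (c : R) (k : K) :
  << c *g k >> = c *: << 1 *g k >> :> {freeg K / R}.
Proof. by apply/eqP/freeg_eqP => x /=; rewrite coeffZ !coeffU mul1r. Qed.

Lemma fglift_is_linear (K : choiceType) (M : lmodType R) (f : K -> M) :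
  linear (fglift f).
Proof.
have fB := @lift_is_additive R K M f.
have f0 : fglift f 0 = 0 by rewrite -(subrr 0) fB subrr.
have fD x y : fglift f (x + y) = fglift f x + fglift f y.
  by rewrite -{1}(opprK y) fB -(add0r (- y)) fB f0 add0r opprK.
have fZ c x : fglift f (c *: x) = c *: fglift f x.
  rewrite -(freeg_sumE x) scaler_sumr.
  rewrite !(big_morph _ fD f0) scaler_sumr; apply: eq_bigr => k _.
  by rewrite freegUZ scalerA -freegUZ -freegUZ !liftU scalerA.
by move=> c x y; rewrite fD fZ.
Qed.

HB.instance Definition _ (K : choiceType) (M : lmodType R) (f : K -> M) :=
  GRing.isLinear.Build R {freeg K / R} M _ (fglift f) (fglift_is_linear f).

Lemma free_projective (K : choiceType) : projective ({freeg K / R} : lmodType R).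
Proof.
move=> A B p f psurj.
pose h k := projT1 (cid (psurj (f << 1 *g k >>))).
have ph k : p (h k) = f << 1 *g k >> by exact: projT2 (cid (psurj _)).
exists (fglift h : {linear _ -> _}) => x /=.
rewrite -(freeg_sumE x) !linear_sum; apply: eq_bigr => k _.
by rewrite freegUZ !linearZ /= liftU scale1r ph.
Qed.

Section Step.
Variable V : lmodType R.

Definition free_cover : lmodType R := {freeg V / R}.
Definition cover_map : {linear free_cover -> V} := fglift (@id V).

Lemma cover_map_surj v : exists x, cover_map x = v.
Proof. by exists << 1 *g v >>; rewrite /cover_map /= liftU scale1r. Qed.

Definition in_ker : pred free_cover := fun x => cover_map x == 0.
Lemma in_ker_submod : submod_closed in_ker.
Proof.
split=> [|a x y]; rewrite !unfold_in /in_ker ?linear0 //.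
by move=> /eqP ex /eqP ey; rewrite linearP ex ey scaler0 addr0.
Qed.
HB.instance Definition _ :=
  GRing.isSubmodClosed.Build R free_cover in_ker in_ker_submod.

Definition ker_type : Type := {x : free_cover | in_ker x}.
HB.instance Definition _ := SubChoice.on ker_type.
HB.instance Definition _ := [SubChoice_isSubLmodule of ker_type by <:].

Definition syzygy : lmodType R := ker_type.
Definition syzygy_incl : {linear syzygy -> free_cover} :=
  (\val : ker_type -> free_cover).

Lemma syzygy_incl_inj x : syzygy_incl x = 0 -> x = 0.
Proof. by move=> x0; apply: val_inj; rewrite raddf0. Qed.

Lemma syzygy_inclP x : cover_map x = 0 <-> exists y, syzygy_incl y = x.
Proof.
split=> [/eqP x0|[[y /eqP y0] <-] //].
by exists (exist _ x x0 : ker_type).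
Qed.

End Step.

Variable M : lmodType R.

Definition free_diff n :
    {linear free_cover (iter n.+1 syzygy M) -> free_cover (iter n syzygy M)} :=
  (@syzygy_incl (iter n syzygy M) \o @cover_map (iter n.+1 syzygy M)
    : {linear _ -> _}).

Lemma free_diff_im n x :
  (exists y, free_diff n y = x) <-> cover_map _ x = 0.
Proof.
rewrite syzygy_inclP; split=> [[y <-]|[y <-]]; first by exists (cover_map _ y).
by have [z <-] := cover_map_surj y; exists z.
Qed.

Lemma free_diff_exact n x : free_diff n x = 0 <-> exists y, free_diff n.+1 y = x.
Proof.
rewrite free_diff_im; split=> [|e]; first exact: syzygy_incl_inj.
by rewrite /free_diff /= e; exact: (raddf0 (@syzygy_incl (iter n syzygy M))).
Qed.

Definition free_resolution : projective_resolution M.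
Proof.
refine (@Build_projective_resolution R M (fun n => free_cover (iter n syzygy M))
  free_diff (cover_map M) _ _ _ free_diff_exact).
- by move=> n; apply: free_projective.
- exact: cover_map_surj.
- by move=> x; exact: iff_sym (@free_diff_im 0%N x).
Defined.

End FreeResolution.

(* Main.v *)
Require Import Defs.
From HB Require Import structures.
From mathcomp Require Import all_boot all_order all_algebra.
From mathcomp Require Import boolp classical_sets.
Import GRing.Theory.
Local Open Scope ring_scope.

(** The first Ext group is half exact in its second argument: from
    0 -> aN -> N -> N/aN -> 0 one sees that Ext^1(M, N) vanishes as soon as
    Ext^1(M, N/aN) and Ext^1(M, aN) do.  If abN = 0 then N/aN is killed by a
    and aN by b, and if ab is regular on M so are a and b.  As every element
    of a principal ideal domain is zero, a unit or a product of irreducibles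
    ([pid_factor_ind]), this leaves r = 0, r a unit and r irreducible.  The
    first two are degenerate: M = 0 or N = 0.

    For r irreducible, R/r is a field and the statement is one about vector
    spaces.  With K the image of P_1 in P_0, a cocycle is a linear map from K
    to N.  Since r is regular on P_0/K = M, the intersection of K and rP_0 is
    rK, on which the map vanishes; it therefore extends by zero to K + rP_0,
    and then to P_0, because P_0/(K + rP_0) is a vector space over R/r
    ([total_extension]).

    In order to run the induction without forming quotient modules, it is
    carried out for the pairs (A, rA) with A a submodule of N: [ext1_vanishes]
    says Ext^1(M, A/rA) = 0 in terms of maps to N.  Linear maps to A/rA become
    linear relations, and a relation that is defined everywhere contains the
    graph of a linear map because P_0 is projective
    ([projective_selection]). *)

(** * Factorization in principal ideal domains *)

Definition irreducible_elt {R : idomainType} (p : R) : Prop :=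
  [/\ p != 0, p \isn't a GRing.unit & forall a b, p = a * b ->
      a \is a GRing.unit \/ b \is a GRing.unit].

Definition multiples {R : idomainType} (a : R) : set R :=
  [set x | exists b, x = b * a]%classic.

Lemma multiples_refl {R : idomainType} (a : R) : multiples a a.
Proof. by exists 1; rewrite mul1r. Qed.

Lemma multiples_ideal {R : idomainType} (a : R) : is_ideal (multiples a).
Proof.
split=> [|x y [b ->] [c ->]|c x [b ->]]; first by exists 0; rewrite mul0r.
- by exists (b + c); rewrite mulrDl.
- by exists (c * b); rewrite mulrA.
Qed.

(** The union of a chain of principal ideals is principal, and its generator
    already lies in a member of the chain. *)
Lemma principal_chain_max {R : idomainType} (F : set (set R)) :
  principal_ideal_domain R ->
  (forall I, F I -> exists a, I = multiples a) ->
  total_on F subset -> (exists I, F I) ->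
  F (\bigcup_(I in F) I)%classic.
Proof.
move=> pidR Fpr Ftot [I0 FI0].
have Fid I : F I -> is_ideal I by move=> /Fpr[a ->]; exact: multiples_ideal.
have [|a Ua] := pidR (\bigcup_(I in F) I)%classic.
  split=> [|x y [I FI Ix] [J FJ Jy]|a x [I FI Ix]].
  - by exists I0 => //; case: (Fid _ FI0).
  - have [IJ|JI] := Ftot _ _ FI FJ.
      by exists J => //; case: (Fid _ FJ) => _ JD _; apply: JD => //; exact: IJ.
    by exists I => //; case: (Fid _ FI) => _ ID _; apply: ID => //; exact: JI.
  - by exists I => //; case: (Fid _ FI) => _ _; apply.
have [I FI Ia] : (\bigcup_(I in F) I)%classic a.
  by apply/Ua; exact: multiples_refl.
suff -> : (\bigcup_(I in F) I)%classic = I by [].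
apply/seteqP; split=> [x /Ua[b ->]|x Ix]; last by exists I.
by case: (Fid _ FI) => _ _; apply.
Qed.

(** An element at which P fails, chosen with maximal principal ideal, is
    neither zero nor a unit nor irreducible, hence it is a product of two
    elements generating strictly larger ideals, and P holds for these. *)
Lemma pid_factor_ind {R : idomainType} (P : R -> Prop) :
  principal_ideal_domain R -> P 0 ->
  (forall u, u \is a GRing.unit -> P u) ->
  (forall p, irreducible_elt p -> P p) ->
  (forall a b, P a -> P b -> P (a * b)) ->
  forall r, P r.
Proof.
move=> pidR P0 Pu Pirr PM r; apply: contrapT => nPr.
(* The empty set is admitted so that the empty chain has an upper bound. *)
pose bad (I : set R) := exists2 a, ~ P a & I = multiples a.
have [F Fbad Ftot|A [Abad Amax]] :=
    @Zorn_bigcup _ (fun I : set R => I = set0 \/ bad I).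
  pose F' : set (set R) := [set I | F I /\ bad I]%classic.
  have UFF' : (\bigcup_(I in F) I = \bigcup_(I in F') I)%classic.
    apply/seteqP; split=> x [I FI Ix]; last by exists I => //; case: FI.
    exists I => //; split=> //; case: (Fbad _ FI) => // I0.
    by rewrite I0 in Ix.
  have [neF'|F'0] := pselect (exists I, F' I).
    right; rewrite UFF'; suff [] : F' (\bigcup_(I in F') I)%classic by [].
    apply: (principal_chain_max _ pidR) => // [I [_ [a _ ->]]|I J [FI _] [FJ _]].
      by exists a.
    exact: Ftot.
  left; rewrite UFF'; apply/seteqP; split=> x // [I F'I _].
  by apply: F'0; exists I.
have Plarger b : (A `<` multiples b)%classic -> P b.
  by move=> /Amax nb; apply: contrapT => nPb; apply: nb; right; exists b.
case: Abad => [A0|[a nPa Aa]].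
  apply/nPr/Plarger; rewrite A0; split=> // /(_ r); apply.
  exact: multiples_refl.
apply: (nPa); apply: Pirr; split.
- by apply/eqP => a0; rewrite a0 in nPa.
- by apply/negP => /Pu.
move=> b c abc; apply: contrapT => /not_orP[/negP nub /negP nuc].
have a0 : a != 0 by apply/eqP => a0; rewrite a0 in nPa.
move: (a0); rewrite abc mulf_eq0 => /norP[b0 c0].
have strict d e : a = d * e -> d != 0 -> e \isn't a GRing.unit ->
    (A `<` multiples d)%classic.
  move=> ade d0 nue; rewrite Aa; split=> [x [k ->]|/(_ d (multiples_refl d))].
    by exists (k * e); rewrite ade (mulrC d) mulrA.
  case=> k; rewrite ade mulrCA -[X in X = _]mulr1 => /(mulfI d0) ke.
  by move/negP: nue; apply; apply/unitrPr; exists k; rewrite mulrC.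
apply: nPa; rewrite abc; apply: PM; apply: Plarger; first exact: strict abc _ _.
by apply: strict nub => //; rewrite abc mulrC.
Qed.

Lemma irreducible_bezout {R : idomainType} (p a : R) :
  principal_ideal_domain R -> irreducible_elt p ->
  (exists c, a = c * p) \/ (exists b c, 1 = b * a + c * p).
Proof.
move=> pidR [_ _ pirr].
have [|d Id] := pidR [set x | exists b c, x = b * a + c * p]%classic.
  split=> [|x y [b [c ->]] [b' [c' ->]]|k x [b [c ->]]].
  - by exists 0, 0; rewrite !mul0r addr0.
  - by exists (b + b'), (c + c'); rewrite !mulrDl addrACA.
  - by exists (k * b), (k * c); rewrite mulrDr !mulrA.
have [k ak] : exists k, a = k * d.
  by apply/Id; exists 1, 0; rewrite mul1r mul0r addr0.
have [l pl] : exists l, p = l * d.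
  by apply/Id; exists 0, 1; rewrite mul1r mul0r add0r.
have [lu|du] := pirr _ _ pl.
  by left; exists (k / l); rewrite pl mulrA divrK.
by right; apply/Id; exists d^-1; rewrite mulVr.
Qed.

(** * Linear relations *)

Definition submodule {R : nzRingType} {V : lmodType R} (S : set V) : Prop :=
  S 0 /\ forall a x y, S x -> S y -> S (a *: x + y).

Section SubmoduleType.
Variables (R : nzRingType) (V : lmodType R) (S : set V) (Ssub : submodule S).

(* The proof of closure is an argument so that instances can refer to it. *)
Definition submodule_pred of submodule S : pred V := fun x => `[< S x >].

Lemma submodule_pred_closed : submod_closed (submodule_pred Ssub).
Proof.
split=> [|a x y]; rewrite !unfold_in; first by apply/asboolP; case: Ssub.
by move=> /asboolP Sx /asboolP Sy; apply/asboolP; apply Ssub.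
Qed.
HB.instance Definition _ :=
  GRing.isSubmodClosed.Build R V (submodule_pred Ssub) submodule_pred_closed.

Definition submodule_type : Type := {x : V | submodule_pred Ssub x}.
HB.instance Definition _ := SubChoice.on submodule_type.
HB.instance Definition _ := [SubChoice_isSubLmodule of submodule_type by <:].

End SubmoduleType.

(** The projection of a total linear relation to its domain is surjective; a
    section of it, which exists by projectivity, is the graph of a linear
    map. *)
Lemma projective_selection {R : idomainType} {V W : lmodType R}
    (G : set (V * W)) :
  projective V -> submodule G -> (forall x, exists n, G (x, n)) ->
  exists g : {linear V -> W}, forall x, G (x, g x).
Proof.
move=> projV Gsub Gtot.
pose T : lmodType R := submodule_type _ _ _ Gsub.
pose i : {linear T -> (V * W)%type} := (\val : submodule_type _ _ _ Gsub -> _).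
have Gi t : G (i t) by apply/asboolP; exact: (valP t).
have [|s sP] := projV T V (fst \o i : {linear _ -> _}) (idfun : {linear _ -> _}).
  move=> x; have [n Gxn] := Gtot x.
  by exists (exist _ (x, n) (asboolT Gxn) : submodule_type _ _ _ Gsub).
exists ((snd \o i) \o s : {linear _ -> _}) => x.
have e : (i (s x)).1 = x := sP x.
by have := Gi (s x); rewrite [i (s x)]surjective_pairing e.
Qed.

(** After dividing V by pV this is the extension of linear maps from subspaces
    to whole spaces over the field R/p, for maps given by relations.  By Zorn's lemma there is a maximal
    G; if x were outside its domain, adding (x, 0) would give a larger one:
    for a nonzero mod p, ax is outside the domain as well, and otherwise
    (ax, 0) already lies in G0.  Extending by (x, 0) also keeps the range. *)
Lemma total_extension {R : idomainType} {V W : lmodType R} (p : R)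
    (G0 : set (V * W)) :
  principal_ideal_domain R -> irreducible_elt p -> submodule G0 ->
  (forall x, G0 (p *: x, 0)) ->
  exists G : set (V * W),
    [/\ submodule G, (G0 `<=` G)%classic, forall x, exists n, G (x, n),
        forall n, G (0, n) -> G0 (0, n) &
        forall x n, G (x, n) -> exists x', G0 (x', n)].
Proof.
move=> pidR pirr G0sub G0p.
pose good (G : set (V * W)) := [/\ submodule G, (G0 `<=` G)%classic,
  forall n, G (0, n) -> G0 (0, n) &
  forall x n, G (x, n) -> exists x', G0 (x', n)].
have good0 : good G0 by split=> // x n ?; exists x.
(* Taking unions with G0 makes G0 the bound of the empty chain. *)
have [F Fgood Ftot|A [Agood Amax]] :=
    @Zorn_bigcup _ (fun A : set (V * W) => good (G0 `|` A)%classic).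
  set U := (G0 `|` _)%classic.
  have common u v : U u -> U v ->
      exists2 G, good G & [/\ (G `<=` U)%classic, G u & G v].
    have FU X : F X -> (G0 `|` X `<=` U)%classic.
      by move=> FX w [?|?]; [left|right; exists X].
    move=> [G0u|[X FX Xu]] [G0v|[Y FY Yv]].
    - by exists G0; [|split=> // w; left].
    - by exists (G0 `|` Y)%classic; [exact: Fgood|split; [exact: FU|left|right]].
    - by exists (G0 `|` X)%classic; [exact: Fgood|split; [exact: FU|right|left]].
    - have [XY|YX] := Ftot _ _ FX FY.
        exists (G0 `|` Y)%classic; [exact: Fgood|split; [exact: FU| |by right]].
        by right; exact: XY.
      exists (G0 `|` X)%classic; [exact: Fgood|split; [exact: FU|by right|]].
      by right; exact: YX.
  split.
  - split=> [|a u v Uu Uv]; first by left; case: G0sub.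
    by have [G [[_ Glin] _ _ _] [GU Gu Gv]] := common _ _ Uu Uv; apply/GU/Glin.
  - by move=> w; left.
  - by move=> n Un; have [G [_ _ G00 _] [_ /G00]] := common _ _ Un Un.
  - by move=> x n Un; have [G [_ _ _ Gr] [_ /Gr]] := common _ _ Un Un.
move: Agood Amax; set G := (G0 `|` A)%classic => Ggood Amax.
case: (Ggood) => Gsub G0G G00 Gr; exists G; split=> // x; apply: contrapT => ndom.
case: (Gsub) => G0' Glin.
have GD u v : G u -> G v -> G (u + v).
  by move=> Gu Gv; rewrite -[u]scale1r; apply: Glin.
have GZ a u : G u -> G (a *: u) by move=> Gu; rewrite -[_ *: _]addr0; apply: Glin.
have Gp y : G (p *: y, 0) by exact/G0G.
pose H : set (V * W) :=
  [set w | exists a u, G u /\ w = (a *: x, 0) + u]%classic.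
have GH : (G `<=` H)%classic.
  by move=> u Gu; exists 0, u; split=> //; rewrite scale0r add0r.
have Hx : H (x, 0).
  by exists 1, 0; split=> //; rewrite scale1r addr0.
have G0H : (G0 `|` H = H)%classic.
  by apply/seteqP; split=> [u [/G0G/GH|]|u] //; right.
apply: (Amax H).
  split=> [u Au|/(_ _ Hx) Ax]; first by apply: GH; right.
  by apply: ndom; exists 0; right.
rewrite G0H; split.
- split; first by apply: GH.
  move=> k _ _ [a [u [Gu ->]]] [b [v [Gv ->]]].
  exists (k * a + b), (k *: u + v); split; first exact: Glin.
  rewrite scalerDr addrACA; congr (_ + _).
  by congr pair; rewrite /= ?scaler0 ?addr0 // scalerDl scalerA.
- by move=> u /G0G/GH.
- move=> n [a [[u m] [Gu [e ->]]]]; apply: G00; rewrite add0r.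
  have [[c ac]|[b [c bc]]] := irreducible_bezout _ a pidR pirr.
    have := GD _ _ (GZ c _ (Gp x)) Gu.
    suff -> : c *: (p *: x, 0) + (u, m) = (0, m) by [].
    by congr pair; rewrite /= ?scaler0 ?add0r // scalerA -ac -e.
  case: ndom; exists (- b *: m).
  have := GD _ _ (GZ (- b) _ Gu) (GZ c _ (Gp x)).
  suff -> : - b *: (u, m) + c *: (p *: x, 0) = (x, - b *: m) by [].
  congr pair; rewrite /= ?scaler0 ?addr0 //.
  have -> : u = - (a *: x) by apply/eqP; rewrite -addr_eq0 addrC -e.
  by rewrite scalerN scaleNr opprK !scalerA -scalerDl -bc scale1r.
- by move=> y n [a [[u m] [/Gr Gm [_ ->]]]]; rewrite add0r.
Qed.

(** * Vanishing of Ext *)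

Section Vanishing.
Variables (R : idomainType) (M : lmodType R) (P : projective_resolution M).

Definition scaled {N : lmodType R} (r : R) (A : set N) : set N :=
  [set n | exists2 m, A m & n = r *: m]%classic.

Lemma scaled_submodule {N : lmodType R} (r : R) (A : set N) :
  submodule A -> submodule (scaled r A).
Proof.
move=> [A0 Alin]; split=> [|a _ _ [m Am ->] [m' Am' ->]].
  by exists 0; rewrite ?scaler0.
exists (a *: m + m'); first exact: Alin.
by rewrite scalerDr !scalerA mulrC.
Qed.

(** Ext^1(M, A/rA) = 0 for all A; as P_0 and P_1 are projective, cochains with
    values in A/rA lift to A. *)
Definition ext1_vanishes (r : R) : Prop :=
  forall (N : lmodType R) (A : set N) (f : {linear P 1%N -> N}),
    submodule A -> (forall y, A (f y)) ->
    (forall w, scaled r A (f (res_d P 1 w))) ->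
    exists2 g : {linear P 0%N -> N}, forall x, A (g x) &
      forall y, scaled r A (f y - g (res_d P 0 y)).

(** The graph of the map to A/rA which a cocycle f modulo rA induces on the
    image of P_1, extended by zero to rP_0. *)
Definition cocycle_relation {N : lmodType R} (r : R) (A : set N)
    (f : {linear P 1%N -> N}) : set (P 0%N * N) :=
  [set w | exists y x m, A m /\
     w = (res_d P 0 y + r *: x, f y + r *: m)]%classic.

Section CocycleRelation.
Variables (N : lmodType R) (r : R) (A : set N) (f : {linear P 1%N -> N}).
Hypotheses (Asub : submodule A) (Af : forall y, A (f y)).
Hypothesis cocf : forall w, scaled r A (f (res_d P 1 w)).

Lemma cocycle_relation_submodule : submodule (cocycle_relation r A f).
Proof.
case: Asub => A0 Alin; split.
  by exists 0, 0, 0; split=> //; rewrite !linear0 !addr0.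
move=> a _ _ [y [x [m [Am ->]]]] [y' [x' [m' [Am' ->]]]].
exists (a *: y + y'), (a *: x + x'), (a *: m + m'); split; first exact: Alin.
by congr pair;
  rewrite /= ?(linearP (res_d P 0)) ?(linearP f) !scalerDr !scalerA (mulrC r a) addrACA.
Qed.

Lemma cocycle_relation_scaled x : cocycle_relation r A f (r *: x, 0).
Proof.
case: Asub => A0 _; exists 0, x, 0; split=> //.
by rewrite !linear0 !add0r.
Qed.

Lemma cocycle_relation_graph y :
  cocycle_relation r A f (res_d P 0 y, f y).
Proof.
case: Asub => A0 _; exists y, 0, 0; split=> //.
by rewrite !scaler0 !addr0.
Qed.

Lemma cocycle_relation_range x n : cocycle_relation r A f (x, n) -> A n.
Proof.
case: Asub => A0 Alin [y [x' [m [Am [_ ->]]]]].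
by rewrite addrC; apply: Alin.
Qed.

(** Regularity says that rP_0 meets the image K of P_1 in rK only, and the
    cocycle is zero modulo rA on rK. *)
Lemma cocycle_relation_fiber0 n :
  regular_on M r -> cocycle_relation r A f (0, n) -> scaled r A n.
Proof.
move=> rM [y [x [m [Am [e ->]]]]]; have [_ Alin] := Asub.
have /res_exact0[z zx] : res_aug P x = 0.
  apply: rM => /=; rewrite scaler0 -linearZ.
  have -> : r *: x = res_d P 0 (- y).
    by rewrite linearN; apply/eqP; rewrite -addr_eq0 addrC -e.
  by apply/res_exact0; exists (- y).
have /res_exact[w wy] : res_d P 0 (y + r *: z) = 0.
  by rewrite linearD linearZ /= zx -e.
have [m' Am' fw] := cocf w.
have -> : f y = r *: (m' - f z).
  by rewrite scalerBr -fw wy linearD linearZ addrK.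
exists (m' - f z + m); last by rewrite [RHS]scalerDr.
have Am'z : A (m' - f z) by rewrite addrC -scaleN1r; apply: Alin.
by rewrite -(scale1r (m' - f z)); apply: Alin.
Qed.

(** The selected map agrees with f on the image of P_1 up to the fibre of G
    over 0. *)
Lemma relation_splits (G : set (P 0%N * N)) :
  submodule G -> (forall x, exists n, G (x, n)) ->
  (forall x n, G (x, n) -> A n) -> (forall n, G (0, n) -> scaled r A n) ->
  (forall y, G (res_d P 0 y, f y)) ->
  exists2 g : {linear P 0%N -> N}, forall x, A (g x) &
      forall y, scaled r A (f y - g (res_d P 0 y)).
Proof.
move=> Gsub Gtot GA G0 Gf.
have [g Gg] := projective_selection G (@res_proj _ _ P 0%N) Gsub Gtot.
exists g => [x|y]; first exact: GA (Gg x).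
apply: G0; have [_ /(_ (-1) _ _ (Gg (res_d P 0 y)) (Gf y))] := Gsub.
suff -> : -1 *: (res_d P 0 y, g (res_d P 0 y)) + (res_d P 0 y, f y)
    = (0, f y - g (res_d P 0 y)) by [].
by congr pair; rewrite /= scaleN1r ?addNr // addrC.
Qed.

End CocycleRelation.

Lemma ext1_vanishes0 : regular_on M 0 -> ext1_vanishes 0.
Proof.
move=> M0 N A f Asub Af cocf.
apply: (relation_splits N 0 A f (cocycle_relation 0 A f)).
- exact: cocycle_relation_submodule.
- move=> x; have /res_exact0[y <-] : res_aug P x = 0.
    by apply: M0; rewrite /= !scale0r.
  by exists (f y); apply: cocycle_relation_graph.
- by move=> x n; apply: cocycle_relation_range.
- by move=> n; apply: cocycle_relation_fiber0.
- by move=> y; apply: cocycle_relation_graph.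
Qed.

Lemma ext1_vanishes_unit u : u \is a GRing.unit -> ext1_vanishes u.
Proof.
move=> uu N A f [A0 Alin] Af cocf; exists (\0 : {linear _ -> _}) => //= y.
exists (u^-1 *: f y); first by rewrite -[_ *: _]addr0; apply: Alin.
by rewrite subr0 scalerA divrr // scale1r.
Qed.

Lemma ext1_vanishes_irreducible p :
  principal_ideal_domain R -> irreducible_elt p -> regular_on M p ->
  ext1_vanishes p.
Proof.
move=> pidR pirr pM N A f Asub Af cocf.
have [G [Gsub G0G Gtot Gker Grange]] := total_extension p _ pidR pirr
  (cocycle_relation_submodule N p A f Asub)
  (cocycle_relation_scaled N p A f Asub).
apply: (relation_splits N p A f G) => //.
- by move=> x n /Grange[x']; apply: cocycle_relation_range.
- by move=> n /Gker; apply: cocycle_relation_fiber0.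
- by move=> y; apply/G0G/cocycle_relation_graph.
Qed.

(** The exact sequence 0 -> aA/abA -> A/abA -> A/aA -> 0: a correction modulo
    aA leaves a cocycle with values in aA. *)
Lemma ext1_vanishesM a b :
  ext1_vanishes a -> ext1_vanishes b -> ext1_vanishes (a * b).
Proof.
move=> va vb N A f Asub Af cocf; have [A0 Alin] := Asub.
have [|g Ag fg] := va N A f Asub Af.
  move=> w; have [m Am ->] := cocf w; exists (b *: m); last by rewrite scalerA.
  by rewrite -[_ *: _]addr0; apply: Alin.
pose f' : {linear P 1%N -> N} := f \- (g \o res_d P 0 : {linear _ -> _}).
have [w|g' Ag' fg'] := vb N (scaled a A) f' (scaled_submodule a A Asub) fg.
  have [m Am fm] := cocf w; exists (a *: m); first by exists m.
  have dd : res_d P 0 (res_d P 1 w) = 0 by apply/res_exact; exists w.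
  by rewrite /f' /= dd linear0 subr0 fm scalerA mulrC.
exists (g \+ g' : {linear _ -> _}) => [x|y] /=.
  have [m Am ->] := Ag' x; rewrite addrC; exact: Alin.
have [_ [m Am ->] e] := fg' y; exists m => //.
by rewrite opprD addrA -[LHS]/(f' y - g' _) e scalerA mulrC.
Qed.

Lemma regular_onMl a b : regular_on M (a * b) -> regular_on M a.
Proof.
by move=> abM x y /= e; apply: abM; rewrite /= mulrC -!scalerA e.
Qed.

Lemma regular_ext1_vanishes r :
  principal_ideal_domain R -> regular_on M r -> ext1_vanishes r.
Proof.
move=> pidR; move: r; apply: pid_factor_ind => //.
- exact: ext1_vanishes0.
- by move=> u uu _; apply: ext1_vanishes_unit.
- by move=> p pirr; apply: ext1_vanishes_irreducible.
- move=> a b va vb abM; apply: ext1_vanishesM.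
    exact: va (regular_onMl _ _ abM).
  by apply: vb; apply: (regular_onMl _ a); rewrite mulrC.
Qed.

End Vanishing.

Theorem corollary1p5 (R : idomainType) (M N : lmodType R)
    (pidR : principal_ideal_domain R)
    (hr : exists r : R, regular_on M r /\ annihilates N r)
    (P : projective_resolution M) :
  forall e : Ext P N 1, e = 0.
Proof.
case: hr => r [rM rN]; apply/Ext_eq0P => f df0.
have fd w : (f : {linear _ -> _}) (res_d P 1 w) = 0.
  by have := congr1 (fun h : Defs.hom (P 2%N) N => (h : {linear _ -> _}) w) df0.
have [||w|g _ fg] := regular_ext1_vanishes R M P r pidR rM N setT f => //.
  by exists 0 => //; rewrite fd scaler0.
exists g; apply: homP => y; have [m _] := fg y.
by rewrite rN => /eqP; rewrite subr_eq0 => /eqP.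
Qed.
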